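(* For all integers $k_1,k_2,n\ge 0$ and every real $x$, $$B_{k_1+k_2}^n(x)=\frac{2^{k_1+k_2-n}\,k_1!\,k_2!}{(k_1+k_2)!}\sum_{j=0}^{n}\binom{n}{j}B_{k_1}^{j}(x)\,B_{k_2}^{n-j}(x),$$ where $B_k^n$ denotes the Bernstein basis function.
   Context: The Bernstein basis functions are $B_k^n(x)=\binom{n}{k}x^k(1-x)^{n-k}$ for integers $0\le k\le n$, with the convention that $B_k^n(x)=0$ when $k<0$ or $k>n$ (and $0^0=1$). *)

(* Defs.v *)
From mathcomp Require Import all_boot all_order all_algebra.
From mathcomp Require Import reals.

Set Implicit Arguments.
Unset Strict Implicit.
Unset Printing Implicit Defensive.

Import Order.TTheory GRing.Theory Num.Theory.

Local Open Scope ring_scope.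

(* The Bernstein basis function B_k^n. The convention B_k^n = 0 for k > n
   holds since 'C(n, k) = 0 then (the truncated exponent n - k being
   immaterial), and x ^+ 0 = 1 for every x, including 0. *)
Definition bernstein (R : realType) (k n : nat) (x : R) : R :=
  'C(n, k)%:R * x ^+ k * (1 - x) ^+ (n - k).

Lemma bernstein_small (R : realType) (k n : nat) (x : R) :
  (n < k)%N -> bernstein k n x = 0.
Proof. by move=> lt_nk; rewrite /bernstein bin_small // !mul0r. Qed.

(* Main.v *)
Require Import Defs.
From mathcomp Require Import all_boot all_order all_algebra.
From mathcomp Require Import reals.
From mathcomp Require Import zify ring.

Set Implicit Arguments.
Unset Strict Implicit.
Unset Printing Implicit Defensive.

Import Order.TTheory GRing.Theory Num.Theory.

Local Open Scope ring_scope.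

(** With n = k1 + k2 + m and j = k1 + i, the j-th product of Bernstein functions
    is x^(k1+k2) (1-x)^m times a multinomial coefficient, which is proportional
    to 'C(m, i); summing over i gives the factor 2^m. All other terms vanish. *)

Lemma bin_mul_bin_fact (k1 k2 m i : nat) : (i <= m)%N ->
  ('C(k1 + k2 + m, k1 + i) * 'C(k1 + i, k1) * 'C(k2 + (m - i), k2) *
     (k1`! * k2`!) = 'C(k1 + k2 + m, k1 + k2) * (k1 + k2)`! * 'C(m, i))%N.
Proof.
move=> le_im.
have bin_addn_fact a b : ('C(a + b, a) * (a`! * b`!) = (a + b)`!)%N.
  by rewrite -(bin_fact (leq_addr b a)) addKn.
apply/eqP; rewrite -(eqn_pmul2r (m := i`! * (m - i)`!)); last first.
  by rewrite muln_gt0 !fact_gt0.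
apply/eqP; transitivity (k1 + k2 + m)`!.
  have -> : (k1 + k2 + m = (k1 + i) + (k2 + (m - i)))%N by lia.
  rewrite -[RHS]bin_addn_fact -(bin_addn_fact k1 i).
  by rewrite -(bin_addn_fact k2 (m - i)%N); ring.
by rewrite -[LHS]bin_addn_fact -(bin_fact le_im); ring.
Qed.

Lemma bernstein_mul_eq0 (R : realType) (k1 k2 n j : nat) (x : R) :
  (j < k1)%N || (n - j < k2)%N ->
  'C(n, j)%:R * bernstein k1 j x * bernstein k2 (n - j) x = 0.
Proof.
by case/orP=> /bernstein_small ->; rewrite ?(mulr0, mul0r).
Qed.

(** The two Bernstein factors contribute (1-x)^i and (1-x)^(m-i), whose product is independent of
    [i]; only the coefficients remain to be compared. *)
Lemma bernstein_mul_shift (R : realType) (k1 k2 m i : nat) (x : R) :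
  (i <= m)%N ->
  (k1`! * k2`!)%:R * ('C(k1 + k2 + m, k1 + i)%:R * bernstein k1 (k1 + i) x *
     bernstein k2 (k1 + k2 + m - (k1 + i)) x) =
  (k1 + k2)`!%:R * bernstein (k1 + k2) (k1 + k2 + m) x * 'C(m, i)%:R.
Proof.
move=> le_im; rewrite /bernstein.
have -> : (k1 + k2 + m - (k1 + i) = k2 + (m - i))%N by lia.
rewrite !addKn.
have -> : (1 - x) ^+ m = (1 - x) ^+ i * (1 - x) ^+ (m - i).
  by rewrite -exprD subnKC.
have /(congr1 (fun a => a%:R : R)) := bin_mul_bin_fact k1 k2 le_im.
rewrite exprD !natrM => coefE.
transitivity ('C(k1 + k2 + m, k1 + k2)%:R * (k1 + k2)`!%:R * 'C(m, i)%:R *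
  (x ^+ k1 * x ^+ k2 * (1 - x) ^+ i * (1 - x) ^+ (m - i)) : R); last by ring.
by rewrite -coefE; ring.
Qed.

(** This is the theorem for n = k1 + k2 + m with denominators cleared. *)
Lemma sum_bernstein_mul (R : realType) (k1 k2 m : nat) (x : R) :
  (k1`! * k2`!)%:R * (\sum_(0 <= j < (k1 + k2 + m).+1)
     'C(k1 + k2 + m, j)%:R * bernstein k1 j x *
     bernstein k2 (k1 + k2 + m - j) x) =
  (k1 + k2)`!%:R * bernstein (k1 + k2) (k1 + k2 + m) x * 2 ^+ m.
Proof.
(* Cut the range at [k1] and [(k1 + m).+1]: the first factor vanishes below, the second above. *)
rewrite (big_cat_nat (n := k1)) //=; last by lia.
rewrite (big_cat_nat (m := k1) (n := (k1 + m).+1)) /=; [|lia|lia].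
rewrite big_nat_cond big1 ?add0r; last first.
  by move=> j; rewrite andbT => /andP[_ lt_j]; rewrite bernstein_mul_eq0 ?lt_j.
rewrite [X in _ + X]big_nat_cond [X in _ + X]big1 ?addr0; last first.
  move=> j; rewrite andbT => /andP[lt_j lt_jn].
  by rewrite bernstein_mul_eq0 //; apply/orP; right; lia.
(* Writing the lower bound as [0 + k1] lets [big_addn] reindex by j = i + k1. *)
rewrite -[X in \sum_(X <= _ < _) _]add0n big_addn subSn ?leq_addr //.
rewrite addKn big_mkord mulr_sumr.
(* Expanding (1 + 1)^m produces the ['C(m, i)], matched term by term. *)
rewrite -[2 in RHS]/(1 + 1) exprDn mulr_sumr; apply: eq_bigr => i _.
rewrite !expr1n mulr1 (addnC (i : nat)) bernstein_mul_shift //.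
by rewrite -ltnS.
Qed.

Theorem theorem10 (R : realType) (k1 k2 n : nat) (x : R) :
  bernstein (k1 + k2) n x =
  (2 : R) ^ (k1%:Z + k2%:Z - n%:Z) * (k1`!)%:R * (k2`!)%:R / ((k1 + k2)`!)%:R *
  \sum_(0 <= j < n.+1) 'C(n, j)%:R * bernstein k1 j x * bernstein k2 (n - j) x.
Proof.
have [lt_nk|le_kn] := ltnP n (k1 + k2).
  (* Both sides are zero: j >= k1 and n - j >= k2 together would force n >= k1 + k2. *)
  rewrite bernstein_small // big_nat_cond big1 ?mulr0 // => j.
  rewrite andbT => /andP[_ le_jn].
  by rewrite bernstein_mul_eq0 //; lia.
rewrite -(subnKC le_kn); set m := (n - _)%N.
have -> : k1%:Z + k2%:Z - (k1 + k2 + m)%:Z = - m%:Z by lia.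
have fact_neq0 : ((k1 + k2)`!)%:R != 0 :> R by rewrite pnatr_eq0 -lt0n fact_gt0.
have two_neq0 : (2 : R) ^+ m != 0 by rewrite expf_neq0 // pnatr_eq0.
have := sum_bernstein_mul k1 k2 m x; rewrite natrM -invr_expz -exprnP.
set S := \sum_(_ <= _ < _) _ => sumE.
apply/esym; transitivity (2 ^- m / (k1 + k2)`!%:R * (k1`!%:R * k2`!%:R * S)).
  by ring.
by rewrite sumE; field; rewrite fact_neq0 two_neq0.
Qed.
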